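(* Let $s\ge 1$ and $k\ge 0$ be integers and let $(X,\mathcal{F})$ be a set system with $\mathrm{opR}_s(\mathcal{F})=k$. Then for every $n$, $$\psi^s_{\mathcal{F}}(n)\le\sum_{i=0}^k(2^s-1)^{n-i}\binom{n}{i}.$$
   Context: A set system $(X,\mathcal{F})$ consists of a set $X$ and a collection $\mathcal{F}\subseteq\mathcal{P}(X)$. Write $[j]=\{0,\dots,j-1\}$; sequences are indexed from $0$. Here $2^s$ also denotes the set of binary sequences of length $s$; $(2^s)^{<n}$ is the set of sequences of length less than $n$ of elements of $2^s$, and $(2^s)^n$ those of length $n$. A $2^s$-ary element tree of height $n$ with labels from $X$ is a labeling of each node $\nu\in(2^s)^{<n}$ by an $s$-tuple $x_\nu=(x_{\nu,0},\dots,x_{\nu,s-1})$ of elements of $X$. A leaf is an element $\xi\in(2^s)^n$. A leaf $\xi$ is properly labeled by a set $A$ if for all $j<n$ and all $i<s$, $x_{\xi|_{[j]},i}\in A$ iff $\xi(j)(i)=1$. The $\mathrm{op}_s$-rank $\mathrm{opR}_s(\mathcal{F})$ is the largest $k<\omega$ such that there is a $2^s$-ary element tree of height $k$ with labels from $X$ such that every leaf is properly labeled by some element of $\mathcal{F}$; it is infinite if there are such trees of arbitrary height, and $-\infty$ if $\mathcal{F}=\emptyset$. The $\mathrm{op}_s$ shatter function $\psi^s_{\mathcal{F}}(n)$ is the maximum number of leaves properly labeled by elements of $\mathcal{F}$ in a $2^s$-ary element tree of height $n$ with labels from $X$. *)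

(* Defs.v *)
From mathcomp Require Import all_boot all_order all_algebra.
From mathcomp Require Import boolp classical_sets constructive_ereal.

Set Implicit Arguments.
Unset Strict Implicit.
Unset Printing Implicit Defensive.

Local Open Scope classical_set_scope.

(* A sequence of length n is a function on [n] = 'I_n. *)
Definition bits (s : nat) := {ffun 'I_s -> bool}.

Definition words (s n : nat) := {ffun 'I_n -> bits s}.

(* A node is a word of length j < n. The domain is kept dependent on n, so
   that a tree of height 0 exists even when X is empty. *)
Definition element_tree (X : Type) (s n : nat) :=
  forall j : 'I_n, words s j -> 'I_s -> X.

Definition restrict (s n : nat) (xi : words s n) (j : 'I_n) : words s j :=
  [ffun i : 'I_j => xi (widen_ord (ltnW (ltn_ord j)) i)].

Definition properly_labeled (X : Type) (s n : nat) (x : element_tree X s n)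
    (xi : words s n) (A : set X) : Prop :=
  forall (j : 'I_n) (i : 'I_s), A (x j (restrict xi j) i) <-> xi j i = true.

Definition labeled_leaf (X : Type) (s : nat) (F : set (set X)) (n : nat)
    (x : element_tree X s n) (xi : words s n) : Prop :=
  exists2 A, F A & properly_labeled x xi A.

Definition has_full_tree (X : Type) (s : nat) (F : set (set X)) (k : nat)
    : Prop :=
  exists x : element_tree X s k, forall xi : words s k, labeled_leaf F x xi.

Definition largest (P : set nat) (k : nat) : Prop :=
  P k /\ forall m, P m -> m <= k.

(* The default 0 of xget is never reached: a nonempty F has a full tree of
   height 0, and in the last branch the heights are bounded. *)
Definition opR (X : Type) (s : nat) (F : set (set X)) : \bar nat :=
  if `[< F = set0 >] then -oo%E
  else if `[< forall m, exists2 k, m <= k & has_full_tree s F k >] then +oo%E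
  else (xget 0 (largest (has_full_tree s F)))%:E%E.

Definition num_labeled (X : Type) (s : nat) (F : set (set X)) (n : nat)
    (x : element_tree X s n) : nat :=
  #|[set xi : words s n | `[< labeled_leaf F x xi >]]%SET|.

(* The maximum over all trees x of num_labeled F x, taken over the attained
   values, which are at most #|words s n|. It is 0 if there is no tree, i.e.
   if X is empty and s, n > 0. *)
Definition psi (X : Type) (s : nat) (F : set (set X)) (n : nat) : nat :=
  \max_(m < #|{: words s n}|.+1
         | `[< exists x : element_tree X s n, num_labeled F x = m >]) m.

(* Main.v *)
Require Import Defs.
From mathcomp Require Import all_boot all_order all_algebra.
From mathcomp Require Import boolp classical_sets constructive_ereal.
From mathcomp Require Import zify.

(** The bound is the Sauer-Shelah argument run on trees, by induction on the
    height n.  Write q = 2^s - 1 and B(n, m) for the sum of q^(n-i) C(n,i) over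
    i < m; the claim is that if F has no full tree of height m, then a tree of
    height n has at most B(n, m) leaves properly labeled by F
    ([num_labeled_bound]).

    The root tuple r of a tree splits F into 2^s pieces, one for each
    membership pattern t on r, and the labeled leaves of the tree above t are
    exactly the leaves of the subtree above t labeled by the piece of t
    ([labeled_leaf_wcons]).  If every piece had a full tree of height m, then
    putting these trees above the root r would give F a full tree of height
    m + 1 ([has_full_tree_glue]).  So if F has none, at least one piece has no
    full tree of height m, while the other q pieces, being subfamilies of F,
    have none of height m + 1.  The count is therefore at most
    B(n, m) + q B(n, m + 1), which is B(n + 1, m + 1) by Pascal's rule
    ([sauer_boundS]).  The corollary is the case m = k + 1. *)

Set Implicit Arguments.
Unset Strict Implicit.
Unset Printing Implicit Defensive.

Local Open Scope classical_set_scope.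

Definition sauer_bound (q n m : nat) : nat :=
  \sum_(0 <= i < m) q ^ (n - i) * 'C(n, i).

(** This is the recursion of the leaf count: one of the [q + 1] subtrees of the
    root satisfies the bound with [m], the [q] others that with [m + 1]. *)
Lemma sauer_boundS q n m :
  sauer_bound q n.+1 m.+1 = sauer_bound q n m + q * sauer_bound q n m.+1.
Proof.
have recr n' l : sauer_bound q n' l.+1 =
    sauer_bound q n' l + q ^ (n' - l) * 'C(n', l).
  by rewrite /sauer_bound big_nat_recr.
elim: m => [|m IHm].
  by rewrite /sauer_bound !big_nat1 big_geq // !bin0 !muln1 !subn0 expnS.
(* if m >= n, the truncated exponents differ but the coefficient vanishes *)
have qC : q * (q ^ (n - m.+1) * 'C(n, m.+1)) = q ^ (n - m) * 'C(n, m.+1).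
  have [lt_mn|le_nm] := ltnP m n; last by rewrite bin_small // !muln0.
  by rewrite mulnA -expnS subnSK.
rewrite recr IHm (recr n m.+1) binS subSS !mulnDr qC (recr n m) !mulnDr.
lia.
Qed.

Lemma sauer_bound_gt0 q m : 0 < sauer_bound q 0 m.+1.
Proof. by rewrite /sauer_bound big_nat_recl // bin0 subnn. Qed.

Section Trees.

Variables (X : Type) (s : nat).
Implicit Types (F : set (set X)) (r : 'I_s -> X) (t : bits s).

Definition wcons n t (w : words s n) : words s n.+1 :=
  [ffun i => oapp w t (unlift ord0 i)].

Definition wtail n (w : words s n.+1) : words s n :=
  [ffun i => w (lift ord0 i)].

Lemma wcons0 n t (w : words s n) : wcons t w ord0 = t.
Proof. by rewrite ffunE unlift_none. Qed.

Lemma wconsS n t (w : words s n) i : wcons t w (lift ord0 i) = w i.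
Proof. by rewrite ffunE liftK. Qed.

Lemma wconsK n t (w : words s n) : wtail (wcons t w) = w.
Proof. by apply/ffunP => i; rewrite ffunE wconsS. Qed.

Lemma wcons_wtail n (w : words s n.+1) : wcons (w ord0) (wtail w) = w.
Proof.
by apply/ffunP => i; rewrite ffunE; case: unliftP => [j|] -> //=; rewrite ffunE.
Qed.

Lemma restrict0 n (w : words s n.+1) :
  restrict w ord0 = [ffun=> [ffun=> false]].
Proof. by apply/ffunP => -[]. Qed.

(** Evaluation at the empty word: words of length 0 are all equal, so the value
    of the constant function is immaterial. *)
Definition tree_root n (x : element_tree X s n.+1) : 'I_s -> X :=
  x ord0 [ffun=> [ffun=> false]].

(** The index [lift ord0 j] has value [j.+1] by conversion, so that
    [wcons t w] is a word of the right length without a cast. *)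
Definition subtree n (x : element_tree X s n.+1) t : element_tree X s n :=
  fun j w => x (lift ord0 j) (wcons t w).

(** Matching on the value of the index keeps everything free of casts: the bound
    [m'.+1 < n.+1] converts to [m' < n]. *)
Definition glue n r (y : bits s -> element_tree X s n) :
    element_tree X s n.+1 :=
  fun j => let: Ordinal m lt_m := j in
    match m return m < n.+1 -> words s m -> 'I_s -> X with
    | 0 => fun _ _ => r
    | m'.+1 => fun lt_m' w => y (w ord0) (Ordinal (lt_m' : m' < n)) (wtail w)
    end lt_m.

Lemma subtree_glue n r (y : bits s -> element_tree X s n) t (j : 'I_n)
    (w : words s j) :
  subtree (glue r y) t w = y t j w.
Proof.
case: j w => j lt_jn w; rewrite /subtree /= wcons0 wconsK.
have irr (lt1 lt2 : j < n) : y t (Ordinal lt1) w = y t (Ordinal lt2) w.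
  by rewrite (bool_irrelevance lt1 lt2).
exact: irr.
Qed.

Lemma restrict_wcons n t (w : words s n) (j : 'I_n) :
  restrict (wcons t w) (lift ord0 j) = wcons t (restrict w j).
Proof.
apply/ffunP => i; rewrite [LHS]ffunE.
case: (unliftP (ord0 : 'I_j.+1) i) => [i'|] ->.
  rewrite [RHS]wconsS [RHS]ffunE -[RHS](wconsS t w); congr (wcons t w _).
  exact: val_inj.
rewrite wcons0 -[RHS](wcons0 t w); congr (wcons t w _).
exact: val_inj.
Qed.

Definition branch F r t : set (set X) :=
  [set A | F A /\ forall i, A (r i) <-> t i = true].

Lemma properly_labeled_wcons n (x : element_tree X s n.+1) t w A :
  properly_labeled x (wcons t w) A <->
  (forall i, A (tree_root x i) <-> t i = true) /\
  properly_labeled (subtree x t) w A.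
Proof.
split=> [xA|[rA xA] j i].
  split=> [i|j i].
    by have := xA ord0 i; rewrite wcons0 restrict0.
  by have := xA (lift ord0 j) i; rewrite restrict_wcons wconsS.
case: (unliftP ord0 j) => [j'|] ->.
  by rewrite restrict_wcons wconsS; apply: xA.
by rewrite wcons0 restrict0; apply: rA.
Qed.

(** Labeling a leaf above [t] imposes the pattern [t] on the root tuple, and
    beyond that only the conditions of the subtree above [t]. *)
Lemma labeled_leaf_wcons F n (x : element_tree X s n.+1) t w :
  labeled_leaf F x (wcons t w) <->
  labeled_leaf (branch F (tree_root x) t) (subtree x t) w.
Proof.
split=> [[A FA /properly_labeled_wcons[rA xA]]|[A [FA rA] xA]].
  by exists A.
by exists A => //; apply/properly_labeled_wcons.
Qed.

Lemma has_full_treeS F F' m :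
  F `<=` F' -> has_full_tree s F m -> has_full_tree s F' m.
Proof.
by move=> sFF' [x xF]; exists x => w; have [A /sFF' FA wA] := xF w; exists A.
Qed.

Lemma has_full_tree0 F : F !=set0 -> has_full_tree s F 0.
Proof.
move=> [A FA]; exists (fun j : 'I_0 => let: Ordinal _ lt := j in
  False_rect _ (notF lt)) => w.
by exists A => // -[].
Qed.

(** The full trees of the branches need not be related to one another: choose
    one for each pattern [t] and use it as the subtree above [t]. *)
Lemma has_full_tree_glue F r m :
  (forall t, has_full_tree s (branch F r t) m) -> has_full_tree s F m.+1.
Proof.
move=> /choice[y yF]; exists (glue r y) => w; rewrite -(wcons_wtail w).
apply/labeled_leaf_wcons; have [A FA wA] := yF (w ord0) (wtail w).
by exists A => // j i; rewrite subtree_glue; apply: wA.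
Qed.

(** Words of length [n + 1] correspond to pairs of a first letter and a word of
    length [n]; grouping the leaves by first letter gives the sum. *)
Lemma num_labeled_branch F n (x : element_tree X s n.+1) :
  num_labeled F x =
  \sum_t num_labeled (branch F (tree_root x) t) (subtree x t).
Proof.
rewrite /num_labeled -sum1_card.
under [RHS]eq_bigr do rewrite -sum1_card.
rewrite pair_big_dep /=.
rewrite (reindex (fun p : bits s * words s n => wcons p.1 p.2)) /=.
  apply: eq_bigl => -[t w]; rewrite !inE /=.
  by apply: asbool_equiv_eq; apply: labeled_leaf_wcons.
exists (fun w : words s n.+1 => (w ord0, wtail w)) => [[t w] _|w _] /=.
  by rewrite wcons0 wconsK.
exact: wcons_wtail.
Qed.

Lemma card_bits : #|{: bits s}| = 2 ^ s.
Proof. by rewrite card_ffun card_bool card_ord. Qed.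

(** The pieces cut out by the root tuple cannot all have full trees of height
    [m] when [F] has none of height [m + 1], so one piece satisfies a better
    bound than the others.  When [m = 0] the bound is 0 and [F] is empty, as a
    nonempty family has a full tree of height 0; when [n = 0 < m] there is a
    single leaf, and the term [i = 0] of the bound is 1. *)
Lemma num_labeled_bound F n m (x : element_tree X s n) :
  ~ has_full_tree s F m -> num_labeled F x <= sauer_bound (2 ^ s - 1) n m.
Proof.
elim: n m F x => [|n IHn] [|m] F x noF.
1,3: suff -> : num_labeled F x = 0 by [].
1,2: apply: eq_card0 => w; rewrite inE; apply/asboolP => -[A FA _].
1,2: by apply/noF/has_full_tree0; exists A.
  apply: leq_trans (sauer_bound_gt0 _ _).
  by rewrite (leq_trans (max_card _)) // card_ffun card_ord.
set r := tree_root x.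
have [t0 not0] : exists t, ~ has_full_tree s (branch F r t) m.
  by apply/existsNP => allF; apply/noF/(has_full_tree_glue allF).
rewrite num_labeled_branch (bigD1 t0) //= sauer_boundS leq_add ?IHn //.
apply: (@leq_trans (\sum_(t | t != t0) sauer_bound (2 ^ s - 1) n m.+1)).
  apply: leq_sum => t _; apply: IHn => /has_full_treeS-/(_ F) fullF.
  by apply/noF/fullF => A [].
by rewrite sum_nat_const cardC1 card_bits subn1.
Qed.

(** Finite rank means that the heights of full trees are nonempty and bounded,
    so they have a maximum and [xget] returns it, not its default. *)
Lemma opR_largest F k :
  opR s F = k%:E%E -> largest (has_full_tree s F) k.
Proof.
rewrite /opR; case: asboolP => // /eqP/set0P F0; case: asboolP => // bndF [<-].
have /existsNP[b noF] := bndF.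
have exF : exists m, `[< has_full_tree s F m >].
  by exists 0; apply/asboolP/has_full_tree0.
have ubF m : `[< has_full_tree s F m >] -> m <= b.
  move=> /asboolP Fm; rewrite leqNgt; apply/negP => lt_bm.
  by apply: noF; exists m => //; apply: ltnW.
case: (ex_maxnP exF ubF) => m /asboolP Fm maxm.
by apply: (@xgetPex _ 0); exists m; split=> // l Fl; apply/maxm/asboolP.
Qed.

End Trees.

Theorem corollary5p7 (s k : nat) (X : Type) (F : set (set X)) :
  1 <= s -> opR s F = k%:E%E ->
  forall n : nat,
    psi s F n <= \sum_(0 <= i < k.+1) (2 ^ s - 1) ^ (n - i) * 'C(n, i).
Proof.
move=> _ /opR_largest[_ maxk] n.
apply/bigmax_leqP => m /asboolP[x <-]; apply: num_labeled_bound.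
by move=> /maxk; rewrite ltnn.
Qed.
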